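(* Let $R$ be a finite commutative ring and $S$ a subset of $R$. Then the following are equivalent: 1. $\Gamma(R,S)$ is a gcd-graph. 2. There exist distinct nonzero principal ideals $\mathcal I_1,\mathcal I_2,\dots,\mathcal I_k$ of $R$ such that for each $r\in R$, $r\in S$ if and only if there exists $1\le i\le k$ with $\mathcal I_i=Rr$.
   Context: All rings are associative and unital. For a finite ring $R$ and a symmetric subset $S\subset R\setminus\{0\}$ (i.e. $S=-S$), the Cayley graph $\Gamma(R,S)$ has vertex set $R$, and $x,y\in R$ are adjacent if and only if $x-y\in S$. $\Gamma(R,S)$ is called a gcd-graph if $S$ is stable under the action of $R^\times$, i.e. $us\in S$ for all $s\in S$ and $u\in R^\times$. Thus statement (1) means that $S$ is a symmetric subset of $R\setminus\{0\}$ that is stable under multiplication by $R^\times$. *)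

(* Defs.v *)
From HB Require Import structures.
From mathcomp Require Import all_boot all_algebra.

Set Implicit Arguments.
Unset Strict Implicit.
Unset Printing Implicit Defensive.

Import GRing.Theory.
Local Open Scope ring_scope.

(* Rings are "possibly zero" (Pz) rings, so that the zero ring is not excluded.
   MathComp's [GRing.unit] is available only for nontrivial rings, whence the
   explicit definition of the unit group. *)
Definition ring_units (R : finPzRingType) : {set R} :=
  [set u | [exists v, (u * v == 1) && (v * u == 1)]].

Definition connection_set (R : finPzRingType) (S : {set R}) : Prop :=
  0 \notin S /\ (forall s, s \in S -> - s \in S).

(* Adjacency relation, on the vertex set R, of the Cayley graph Gamma(R, S). *)
Definition cayley_graph (R : finPzRingType) (S : {set R}) : rel R :=
  [rel x y | x - y \in S].

Lemma cayley_graphP (R : finPzRingType) (S : {set R}) :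
  connection_set S <->
  irreflexive (cayley_graph S) /\ symmetric (cayley_graph S).
Proof.
split=> [[S0 SN] | [irr sym]].
  split=> [x | x y]; rewrite /cayley_graph /=; first by rewrite subrr (negbTE S0).
  by apply/idP/idP => /SN; rewrite opprB.
split=> [|s Ss]; first by move: (irr 0); rewrite /cayley_graph /= subrr => ->.
by move: (sym s 0); rewrite /cayley_graph /= subr0 sub0r Ss => <-.
Qed.

(* A property of the pair (R, S) defining Gamma(R, S). *)
Definition gcd_graph (R : finPzRingType) (S : {set R}) : Prop :=
  connection_set S /\
  (forall u s, u \in ring_units R -> s \in S -> u * s \in S).

Definition principal_ideal (R : finComPzRingType) (r : R) : {set R} :=
  [set x * r | x : R].

Definition is_principal_ideal (R : finComPzRingType) (I : {set R}) : Prop :=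
  exists a : R, I = principal_ideal a.

(* Main.v *)
Require Import Defs.
From mathcomp Require Import all_boot all_algebra.
Local Open Scope ring_scope.

(** In a finite commutative ring, two elements generate the same ideal if and
    only if they differ by a unit.  Indeed if a = x b and b = y a, some power
    e = (x y)^n with n > 0 is idempotent and fixes b, so that
    u = x e + (1 - e) is a unit with u b = a.  Hence a set of ring elements is
    stable under units exactly when membership of r depends only on R r. *)

Import GRing.Theory.

(** By pigeonhole the powers of [t] are periodic from some exponent [i] on, with period [d.+1]; any
    positive multiple of the period that is at least [i] is then an idempotent exponent. *)
Lemma exists_idempotent_exp (R : finPzRingType) (t : R) :
  exists n, t ^+ n.+1 * t ^+ n.+1 = t ^+ n.+1.
Proof.
have /injectivePn [i0 [j0 ne_ij eq_t]] :
    ~~ injectiveb (fun i : 'I_#|R|.+1 => t ^+ i).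
  by apply/injectiveP => /leq_card; rewrite card_ord ltnn.
have [i [d Etd]] : exists i d, t ^+ (i + d.+1) = t ^+ i.
  move: ne_ij; rewrite -val_eqE neq_ltn => /orP[] lt_ij.
    by exists i0, (j0 - i0.+1)%N; rewrite addnS -addSn subnKC.
  by exists j0, (i0 - j0.+1)%N; rewrite addnS -addSn subnKC.
have period m k : (i <= m)%N -> t ^+ (m + k * d.+1) = t ^+ m.
  move=> /subnK <-; elim: k => [|k IHk]; first by rewrite addn0.
  by rewrite mulSn (addnC d.+1) addnACA exprD Etd -exprD addnAC.
(* The successor of this witness is [i.+1 * d.+1]. *)
exists (d + i * d.+1)%N; rewrite -exprD -addSn -mulSn period //.
by rewrite mulSn mulnS addnCA leq_addr.
Qed.

Lemma mem_principal_ideal (R : finComPzRingType) (r : R) :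
  r \in principal_ideal r.
Proof. by apply/imsetP; exists 1; rewrite ?mul1r. Qed.

Lemma principal_ideal0 (R : finComPzRingType) :
  principal_ideal (0 : R) = [set 0].
Proof.
apply/setP=> z; rewrite inE; apply/imsetP/eqP => [[x _ ->]|->].
  by rewrite mulr0.
by exists 0; rewrite ?mulr0.
Qed.

Lemma principal_ideal_unitM (R : finComPzRingType) (u r : R) :
  u \in ring_units R -> principal_ideal (u * r) = principal_ideal r.
Proof.
rewrite inE => /existsP[v /andP[_ /eqP vu]].
apply/setP=> z; apply/imsetP/imsetP => -[x _ ->].
  by exists (x * u); rewrite // mulrA.
by exists (x * v); rewrite // -mulrA (mulrA v) vu mul1r.
Qed.

Lemma eq_principal_ideal_unit (R : finComPzRingType) (a b : R) :
  principal_ideal a = principal_ideal b ->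
  exists2 u, u \in ring_units R & a = u * b.
Proof.
move=> eq_ab.
have /imsetP[x _ Ea] : a \in principal_ideal b.
  by rewrite -eq_ab mem_principal_ideal.
have /imsetP[y _ Eb] : b \in principal_ideal a.
  by rewrite eq_ab mem_principal_ideal.
have [n ee] := exists_idempotent_exp R (x * y).
set e := (x * y) ^+ n.+1 in ee.
have eb : e * b = b.
  have xyb : x * y * b = b by rewrite (mulrC x) -mulrA -Ea -Eb.
  rewrite /e; elim: n.+1 => [|m IHm]; first by rewrite mul1r.
  by rewrite exprSr -mulrA xyb.
(* [f] is the complementary idempotent [1 - e], kept abstract: only these four equations are
   used. *)
have [f [ef ff fb addef]] :
    exists f, [/\ e * f = 0, f * f = f, f * b = 0 & e + f = 1].
  exists (1 - e); have ef : e * (1 - e) = 0 by rewrite mulrBr mulr1 ee subrr.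
  by rewrite ef mulrBl ef mul1r subr0 mulrBl mul1r eb subrr subrKC.
(* [w] inverts [x] on the component cut out by [e]; adding [f], the identity of the other component,
   gives mutually inverse units of [R]. *)
pose w := y * (x * y) ^+ n.
have xw : x * w = e by rewrite mulrA -exprS.
have uv : (x * e + f) * (w * e + f) = 1.
  rewrite mulrDl !mulrDr mulrACA xw !ee ff -mulrA ef mulr0 addr0.
  by rewrite (mulrC f) -mulrA ef mulr0 add0r.
exists (x * e + f); last by rewrite mulrDl -mulrA eb fb addr0.
rewrite inE; apply/existsP; exists (w * e + f).
by rewrite (mulrC (w * e + f)) uv eqxx.
Qed.

Theorem proposition2p5 (R : finComPzRingType) (S : {set R}) :
  gcd_graph S <->
  (exists (k : nat) (I : 'I_k -> {set R}),
    [/\ injective I,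
        (forall i : 'I_k, is_principal_ideal (I i) /\ I i <> [set 0]) &
        (forall r : R, r \in S <-> exists i : 'I_k, I i = principal_ideal r)]).
Proof.
split=> [[[S0 _] SU] | [k [I [_ I_nz SP]]]].
  (* Collecting the ideals in a set merges repetitions, so its enumeration is injective. *)
  pose A := [set principal_ideal s | s in S].
  exists #|A|, (fun i => enum_val i); split; first exact: enum_val_inj.
    move=> i; have /imsetP[s Ss ->] := enum_valP i; split; first by exists s.
    move=> s0; have := mem_principal_ideal R s; rewrite s0 inE => /eqP s_eq0.
    by rewrite -s_eq0 Ss in S0.
  move=> r; split=> [Sr | [i]].
    have Ar : principal_ideal r \in A by apply: imset_f.
    by exists (enum_rank_in Ar (principal_ideal r)); rewrite enum_rankK_in.
  have /imsetP[s Ss ->] := enum_valP i.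
  by move=> /esym/eq_principal_ideal_unit[u Uu ->]; apply: SU.
have SU u s : u \in ring_units R -> s \in S -> u * s \in S.
  by move=> Uu /SP[i Ii]; apply/SP; exists i; rewrite principal_ideal_unitM.
split=> //; split=> [|s Ss].
  by apply/negP => /SP[i]; rewrite principal_ideal0; case: (I_nz i).
(* Symmetry is stability under the unit [-1]. *)
rewrite -mulN1r; apply: SU => //.
by rewrite inE; apply/existsP; exists (-1); rewrite mulrNN mulr1 eqxx.
Qed.
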